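(* Let $X$ be a completely regular space, let $\{f_U\colon U\in\operatorname{RO}(X)\}$ be an $\operatorname{RO}(X)$-stratification, and for $U\in\operatorname{RO}(X)$ and $q\in\mathbb{I}$ put $U_q=f_U^{-1}((q,1])$. Suppose that for every decreasing (possibly transfinite) sequence $(U^\alpha)$ of regular open subsets of $X$, with $W=\operatorname{int}\bigcap_\alpha U^\alpha$, we have $f_W(x)=\inf_\alpha f_{U^\alpha}(x)$ for every $x\in X$. Then for every decreasing (possibly transfinite) sequence $(U^\alpha)$ of regular open subsets of $X$ and all $p<q$ in $\mathbb{I}$, $$\bigcap_\alpha\operatorname{cl}(U^\alpha_q)\subseteq\Bigl(\operatorname{int}\bigcap_\alpha U^\alpha\Bigr)_p.$$
   Context: $\mathbb{I}=(0,1)\cap\mathbb{Q}$. A subset $U$ of a topological space $X$ is regular open if $U=\operatorname{int}\operatorname{cl}U$; $\operatorname{RO}(X)$ is the family of all regular open subsets of $X$. An $\operatorname{RO}(X)$-stratification of a $T_0$-space $X$ is a family of functions $\{f_U\colon U\in\operatorname{RO}(X)\}$, $f_U\colon X\to[0,1]$, such that: (1) $U=f_U^{-1}((0,1])$ for every $U\in\operatorname{RO}(X)$; (2) if $U,V\in\operatorname{RO}(X)$ and $U\subseteq V$, then $f_U(x)\leqslant f_V(x)$ for every $x\in X$; (3) each $f_U$ is continuous. For a regular open set $W$ and $p\in\mathbb{I}$, $(W)_p$ denotes $f_W^{-1}((p,1])$. *)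

(* Defs.v *)
From mathcomp Require Import all_boot all_order all_algebra.
From mathcomp Require Import all_classical all_reals all_analysis.
Set Implicit Arguments.
Unset Strict Implicit.
Unset Printing Implicit Defensive.
Import Order.TTheory GRing.Theory Num.Theory.
Import numFieldNormedType.Exports.
Local Open Scope classical_set_scope.
Local Open Scope ring_scope.

(* The family is indexed by all subsets of X, but only its members f U with U
   regular open are constrained or used; values at other subsets are junk. *)
Record RO_stratification (R : realType) (X : topologicalType)
    (f : set X -> X -> R) : Prop := {
  RO_strat_unit : forall U, regopen U -> forall x, f U x \in `[0, 1] ;
  RO_strat_supp : forall U, regopen U -> U = f U @^-1` `]0, 1] ;
  RO_strat_mono : forall U V, regopen U -> regopen V -> U `<=` V ->
    forall x, f U x <= f V x ;
  RO_strat_cont : forall U, regopen U -> continuous (f U) }.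

Definition RO_level (R : realType) (X : topologicalType)
    (f : set X -> X -> R) (U : set X) (q : rat) : set X :=
  f U @^-1` `](ratr q), 1].

(* A transfinite sequence is a family indexed by a nonempty well-ordered type
   (I, le), i.e. by a nonzero ordinal up to isomorphism; "decreasing" is meant
   in the weak sense. *)
Record decreasing_RO_seq (X : topologicalType) (I : Type) (le : rel I)
    (U : I -> set X) : Prop := {
  dec_RO_inhabited : inhabited I ;
  dec_RO_well_order : wochoice.well_order le ;
  dec_RO_regopen : forall a, regopen (U a) ;
  dec_RO_decreasing : forall a b, le a b -> U b `<=` U a }.

(* In particular f_W makes sense for W the interior of the intersection of a
   sequence of regular open sets. *)
Lemma regopen_interior_bigcap (X : topologicalType) (I : Type)
    (U : I -> set X) :
  (forall a, regopen (U a)) -> regopen (interior (\bigcap_a U a)).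
Proof.
move=> rU; rewrite /regopen eqEsubset; split; last first.
  apply: subset_trans (interiorS (@subset_closure _ _)).
  by rewrite (iffLR (interior_id _) (@open_interior _ _)).
rewrite -[X in X `<=` _](iffLR (interior_id _) (@open_interior _ _)).
apply: interiorS => x xW a _; rewrite -(rU a).
by apply: interiorS xW; apply: closureS => y /interior_subset; apply.
Qed.

(* Main.v *)
Require Import Defs.
From mathcomp Require Import all_boot all_order all_algebra.
From mathcomp Require Import all_classical all_reals all_analysis.
Import Order.TTheory GRing.Theory Num.Theory.
Import numFieldNormedType.Exports.
Local Open Scope classical_set_scope.
Local Open Scope ring_scope.

(** By continuity of each [f (U a)], a point in the closure of the [q]-level of [U a] still
    satisfies the weak bound [ratr q <= f (U a) x]. A bound uniform in [a] passes to the infimum,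
    which [f_inf] identifies with the value at [x] of the function of the interior of the
    intersection. The gap [p < q] restores the strict inequality lost in the closure. *)

Theorem proposition5 (R : realType) (X : topologicalType)
    (X_T0 : kolmogorov_space X) (X_creg : completely_regular_space X)
    (f : set X -> X -> R) (f_strat : RO_stratification f)
    (f_inf : forall (I : Type) (le : rel I) (U : I -> set X),
      decreasing_RO_seq le U ->
      forall x : X,
        f (interior (\bigcap_a U a)) x = inf (range (fun a => f (U a) x))) :
  forall (I : Type) (le : rel I) (U : I -> set X),
    decreasing_RO_seq le U ->
    forall p q : rat, p \in `]0, 1[ -> q \in `]0, 1[ -> p < q ->
      \bigcap_a closure (RO_level f (U a) q)
        `<=` RO_level f (interior (\bigcap_a U a)) p.
Proof.
move=> I le U Udec p q _ _ ltpq x xcl.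
have [[a0] _ Uro _] := Udec.
have leq a : ratr q <= f (U a) x.
  have clq : closed (f (U a) @^-1` [set y | ratr q <= y]).
    apply: preimage_closed (@closed_ge R (ratr q)) => y _.
    exact: (RO_strat_cont f_strat (Uro a)).
  apply: clq; move: (xcl a Logic.I); apply: closureS => y.
  by rewrite /RO_level /= in_itv /= => /andP[/ltW].
have Wro := regopen_interior_bigcap Uro.
(* The upper end of the interval [](ratr p), 1]] comes from the range of the stratification; only
   the strict lower bound is left. *)
have := RO_strat_unit f_strat Wro x; rewrite /RO_level /= !in_itv /=.
move=> /andP[_ ->]; rewrite andbT (f_inf _ _ _ Udec).
apply: (@lt_le_trans _ _ (ratr q)); first by rewrite ltr_rat.
(* The index [a0] makes the range nonempty, so that [inf] is a genuine infimum and not a default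
   value. *)
by apply: lb_le_inf; [exists (f (U a0) x), a0 | move=> _ [a _ <-]].
Qed.
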